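(* There are exactly $74$ two-dimensional number-conserving binary cellular automata on $\mathbb{Z}^2$ with the $2\times 3$-neighborhood. Precisely, a local rule $f:\{0,1\}^6\to\{0,1\}$ with the $2\times 3$-neighborhood induces a number-conserving cellular automaton if and only if its global rule $F$ is one of the following $74$ pairwise distinct maps: (1) (Class $(\Omega,\emptyset)$, $6$ maps) the identity $\mathrm{Id}$, or one of the five shifts along the vectors $[-1,0]$, $[1,0]$, $[0,1]$, $[1,1]$, $[-1,1]$; (2) (Class $(\mathrm{Id},\Lambda)$, $\Lambda\neq\emptyset$, $34$ maps) $F=T_{C_l,C_r}$, where $(C_l,C_r)$ is a pair of subsets of $\{00,01,10,11\}$ such that either exactly one of $C_l,C_r$ is empty ($15$ choices with $C_r=\emptyset$ and $15$ choices with $C_l=\emptyset$), or $(C_l,C_r)$ is one of the four pairs $(\{00\},\{11\})$, $(\{01\},\{01\})$, $(\{10\},\{10\})$, $(\{11\},\{00\})$; (3) (Class $(\mathrm{Su},\Lambda)$, $\Lambda\neq\emptyset$, $34$ maps) $F=ST_{C_l,C_r}$, where $(C_l,C_r)$ ranges over the same $34$ pairs as in (2).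
   Context: The cellular space is $\mathbb{Z}^2$, the state set is $\{0,1\}$ (state $1$ is a particle, state $0$ an empty space). A configuration is a map $\mathbf{x}:\mathbb{Z}^2\to\{0,1\}$, with $x_{i,j}$ the state of cell $(i,j)$; $X$ is the set of configurations. A configuration is finite if only finitely many cells have a non-zero state. A binary cellular automaton with the $2\times 3$-neighborhood is given by a local rule $f:\{0,1\}^6\to\{0,1\}$, inducing the global rule $F:X\to X$, $$F(\mathbf{x})_{i,j}=f(x_{i-1,j},\,x_{i,j},\,x_{i+1,j},\,x_{i-1,j-1},\,x_{i,j-1},\,x_{i+1,j-1}).$$ It is number-conserving if $\sum_{(i,j)\in\mathbb{Z}^2}F(\mathbf{x})_{i,j}=\sum_{(i,j)\in\mathbb{Z}^2}x_{i,j}$ for every finite configuration $\mathbf{x}\in X$. The shift along a vector $[a,b]$ is the map $F(\mathbf{x})_{i,j}=x_{i-a,j-b}$. $\mathrm{Su}$ denotes the shift-up rule, i.e. the shift along $[0,1]$. For $C_l,C_r\subseteq\{00,01,10,11\}$ (an element $ab$ stands for the two-letter word with letters $a,b\in\{0,1\}$), $T_{C_l,C_r}$ denotes the identity with the conditional traffic-left rule under condition $C_l$ and the conditional traffic-right rule under condition $C_r$ (an empty condition means the corresponding rule is absent). That is, each particle stays in its cell, except that: a particle in cell $(i,j)$ moves to cell $(i+1,j)$ if and only if $x_{i+1,j}=0$ and $x_{i,j-1}x_{i+1,j-1}\in C_r$; and a particle in cell $(i,j)$ moves to cell $(i-1,j)$ if and only if $x_{i-1,j}=0$ and $x_{i-1,j-1}x_{i,j-1}\in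 C_l$. With $[P]$ equal to $1$ if $P$ holds and $0$ otherwise, $$T_{C_l,C_r}(\mathbf{x})_{i,j}=x_{i,j}-[x_{i,j}=1,\,x_{i+1,j}=0,\,x_{i,j-1}x_{i+1,j-1}\in C_r]+[x_{i-1,j}=1,\,x_{i,j}=0,\,x_{i-1,j-1}x_{i,j-1}\in C_r]$$ $$-[x_{i,j}=1,\,x_{i-1,j}=0,\,x_{i-1,j-1}x_{i,j-1}\in C_l]+[x_{i+1,j}=1,\,x_{i,j}=0,\,x_{i,j-1}x_{i+1,j-1}\in C_l].$$ Similarly, $ST_{C_l,C_r}$ denotes the shift-up rule with the shifted conditional traffic-left rule under condition $C_l$ and the shifted conditional traffic-right rule under condition $C_r$ (an empty condition means the rule is absent). That is, each particle in cell $(i,j-1)$ moves to cell $(i,j)$, except that: it moves instead to $(i+1,j)$ if and only if $x_{i+1,j-1}=0$ and $x_{i,j}x_{i+1,j}\in C_r$; and it moves instead to $(i-1,j)$ if and only if $x_{i-1,j-1}=0$ and $x_{i-1,j}x_{i,j}\in C_l$. In formulas, $$ST_{C_l,C_r}(\mathbf{x})_{i,j}=x_{i,j-1}-[x_{i,j-1}=1,\,x_{i+1,j-1}=0,\,x_{i,j}x_{i+1,j}\in C_r]+[x_{i-1,j-1}=1,\,x_{i,j-1}=0,\,x_{i-1,j}x_{i,j}\in C_r]$$ $$-[x_{i,j-1}=1,\,x_{i-1,j-1}=0,\,x_{i-1,j}x_{i,j}\in C_l]+[x_{i+1,j-1}=1,\,x_{i,j-1}=0,\,x_{i,j}x_{i+1,j}\in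 C_l].$$ For all pairs $(C_l,C_r)$ listed in the claim, these expressions take values in $\{0,1\}$. *)

(* Defs.v *)
From mathcomp Require Import all_boot all_order all_algebra.
From mathcomp Require Import mathcomp_extra boolp classical_sets functions.
From mathcomp Require Import cardinality fsbigop.

Set Implicit Arguments.
Unset Strict Implicit.
Unset Printing Implicit Defensive.

Import GRing.Theory.

Local Open Scope classical_set_scope.
Local Open Scope ring_scope.

Definition cell : Type := (int * int)%type.
Definition config : Type := cell -> bool.

Definition finite_config (x : config) : Prop := finite_set [set c | x c].

Definition local_rule : Type :=
  bool -> bool -> bool -> bool -> bool -> bool -> bool.

Definition global_rule (f : local_rule) (x : config) : config :=
  fun '(i, j) =>
    f (x (i - 1, j)) (x (i, j)) (x (i + 1, j))
      (x (i - 1, j - 1)) (x (i, j - 1)) (x (i + 1, j - 1)).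

(* The sum over an infinite support is a junk value (0) for the finitely
   supported big operator, whereas the actual sum is then infinite and differs
   from that of any finite configuration; hence the explicit finiteness. *)
Definition number_conserving (F : config -> config) : Prop :=
  forall x : config, finite_config x ->
    finite_config (F x) /\
    \sum_(c \in [set: cell]) (F x c : nat)%:Z =
    \sum_(c \in [set: cell]) (x c : nat)%:Z.

Definition number_conserving_CA : set (config -> config) :=
  [set F | (exists f : local_rule, F = global_rule f) /\ number_conserving F].

Definition shift (v : int * int) (x : config) : config :=
  fun '(i, j) => x (i - v.1, j - v.2).

Definition shift_vectors : seq (int * int) :=
  [:: (-1, 0); (1, 0); (0, 1); (1, 1); (-1, 1)].

(* The pair (a, b) is the two-letter word ab. *)
Definition word : finType := (bool * bool)%type.

Definition w00 : word := (false, false).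
Definition w01 : word := (false, true).
Definition w10 : word := (true, false).
Definition w11 : word := (true, true).

Section Traffic.
Variables (Cl Cr : {set word}) (x : config).

Definition T_value (c : cell) : int :=
  let: (i, j) := c in
  (x (i, j) : nat)%:Z
  - ([&& x (i, j), ~~ x (i + 1, j)
       & (x (i, j - 1), x (i + 1, j - 1)) \in Cr] : nat)%:Z
  + ([&& x (i - 1, j), ~~ x (i, j)
       & (x (i - 1, j - 1), x (i, j - 1)) \in Cr] : nat)%:Z
  - ([&& x (i, j), ~~ x (i - 1, j)
       & (x (i - 1, j - 1), x (i, j - 1)) \in Cl] : nat)%:Z
  + ([&& x (i + 1, j), ~~ x (i, j)
       & (x (i, j - 1), x (i + 1, j - 1)) \in Cl] : nat)%:Z.

Definition ST_value (c : cell) : int :=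
  let: (i, j) := c in
  (x (i, j - 1) : nat)%:Z
  - ([&& x (i, j - 1), ~~ x (i + 1, j - 1)
       & (x (i, j), x (i + 1, j)) \in Cr] : nat)%:Z
  + ([&& x (i - 1, j - 1), ~~ x (i, j - 1)
       & (x (i - 1, j), x (i, j)) \in Cr] : nat)%:Z
  - ([&& x (i, j - 1), ~~ x (i - 1, j - 1)
       & (x (i - 1, j), x (i, j)) \in Cl] : nat)%:Z
  + ([&& x (i + 1, j - 1), ~~ x (i, j - 1)
       & (x (i, j), x (i + 1, j)) \in Cl] : nat)%:Z.

End Traffic.

(* For the pairs in [conditions] the integer values are 0 or 1 and this
   decoding loses nothing: see [trafficE] and [shifted_trafficE]. *)
Definition traffic (C : {set word} * {set word}) (x : config) : config :=
  fun c => T_value C.1 C.2 x c == 1.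

Definition shifted_traffic (C : {set word} * {set word}) (x : config) :
    config :=
  fun c => ST_value C.1 C.2 x c == 1.

(* (+) is exclusive or: exactly one of C_l, C_r is empty. *)
Definition conditions : {set {set word} * {set word}} :=
  ([set C | (C.1 == finset.set0) (+) (C.2 == finset.set0)]
   :|: [set ([set w00], [set w11]); ([set w01], [set w01]);
            ([set w10], [set w10]); ([set w11], [set w00])])%SET.

Definition class_shift : seq (config -> config) :=
  idfun :: [seq shift v | v <- shift_vectors].
Definition class_traffic : seq (config -> config) :=
  [seq traffic C | C <- enum conditions].
Definition class_shifted_traffic : seq (config -> config) :=
  [seq shifted_traffic C | C <- enum conditions].

Definition listed_maps : seq (config -> config) :=
  class_shift ++ class_traffic ++ class_shifted_traffic.

Lemma trafficE (C : {set word} * {set word}) (x : config) (c : cell) :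
  C \in conditions -> (traffic C x c : nat)%:Z = T_value C.1 C.2 x c.
Proof.
case: C c => Cl Cr [i j]; rewrite /traffic /T_value /conditions !inE /=.
move: (x _) (x (i + 1, j)) (x (i - 1, j)) (x (i, j - 1))
  (x (i + 1, j - 1)) (x (i - 1, j - 1)) => a b d e g h.
case/orP => [|/orP[/orP[/orP[]|]|]].
- case: eqVneq => [->|_]; case: eqVneq => [->|_] //= _; rewrite !finset.in_set0 !andbF;
  by case: a; case: b; case: d; case: (_ \in _); case: (_ \in _).
all: by case/eqP=> -> ->; rewrite !finset.in_set1;
  case: a; case: b; case: d; case: e; case: g; case: h.
Qed.

Lemma shifted_trafficE (C : {set word} * {set word}) (x : config) (c : cell) :
  C \in conditions ->
  (shifted_traffic C x c : nat)%:Z = ST_value C.1 C.2 x c.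
Proof.
case: C c => Cl Cr [i j]; rewrite /shifted_traffic /ST_value /conditions !inE /=.
move: (x (i, j)) (x (i + 1, j)) (x (i - 1, j)) (x (i, j - 1))
  (x (i + 1, j - 1)) (x (i - 1, j - 1)) => a b d e g h.
case/orP => [|/orP[/orP[/orP[]|]|]].
- case: eqVneq => [->|_]; case: eqVneq => [->|_] //= _; rewrite !finset.in_set0 !andbF;
  by case: e; case: g; case: h; case: (_ \in _); case: (_ \in _).
all: by case/eqP=> -> ->; rewrite !finset.in_set1;
  case: a; case: b; case: d; case: e; case: g; case: h.
Qed.

(* Main.v *)
Require Import Defs.
From mathcomp Require Import all_boot all_order all_algebra.
From mathcomp Require Import mathcomp_extra boolp classical_sets functions.
From mathcomp Require Import cardinality fsbigop.
From mathcomp Require Import ring.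

Local Open Scope classical_set_scope.
Local Open Scope card_scope.

(** A rule is conserving only if it preserves the number of particles of the
configurations whose particles all lie in one 2 x 3 window.  The image of such
a configuration is supported in the finitely many cells that observe a particle
(the empty neighborhood must be sent to 0, otherwise the image of the empty
configuration would be infinite), so that each of the 64 patterns of the window
gives a linear equation between values of the local rule
([observers_total]).  The values of the rule on the 64 neighborhood patterns
are then 64 unknowns in {0,1}.  The equation of a pattern only involves its
sub-patterns and their translates, hence patterns with at most as many
particles; assigning the unknowns by increasing number of particles, and
dropping a partial assignment as soon as an equation can no longer be satisfied,
keeps the search tree small (fewer than 500 nodes per level), and its leaves are
truth tables of the 74 listed rules ([mem_balanced_tables],
[exhaustive_search]).

Conversely, every listed map moves all particles along a vector [v], up to a
flow between horizontal neighbors: F(x)_c = x_(c - v) - J(x)_c + J(x)_(c - e),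
where e = (1, 0) and J(x)_c is the net number of particles that cross to the
right between c and c + e, after the move (J = 0 for the shifts).  Summing over
the plane, the two flux terms cancel ([flux_conserving]).

A cellular automaton determines its local rule, so that two listed maps are
distinct as soon as their truth tables are ([global_rule_inj]); the count of 74
is read off the tables.  To make the listed rules computable, subsets of
{00,01,10,11} are represented by sublists of [letters], a representation shown
to be faithful by [perm_enum_conditions]. *)

Set Implicit Arguments.
Unset Strict Implicit.
Unset Printing Implicit Defensive.

(** * Neighborhood patterns and balance equations *)

Section Balance.
Import GRing.Theory.
Local Open Scope ring_scope.

Definition offsets : seq cell :=
  [:: (-1, 0); (0, 0); (1, 0); (-1, -1); (0, -1); (1, -1)].

(** The values in the order in which a local rule takes its arguments. *)
Definition view (x : config) (c : cell) : bitseq :=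
  [seq x (c + o) | o <- offsets].

Definition apply_rule (f : local_rule) (w : bitseq) : bool :=
  if w is [:: a; b; c; d; e; g] then f a b c d e g else false.

Lemma global_ruleE f x c : global_rule f x c = apply_rule f (view x c).
Proof.
case: c => i j.
have add2E (k l : int) : (i, j) + (k, l) = (i + k, j + l) by [].
by rewrite /view /= !add2E !addr0.
Qed.

Fixpoint bitseqs (n : nat) : seq bitseq :=
  if n is n'.+1 then
    [seq false :: w | w <- bitseqs n'] ++ [seq true :: w | w <- bitseqs n']
  else [:: [::]].

(** The order by number of particles matters for the search: the equation of a
pattern only involves patterns that come earlier or have equally many
particles. *)
Definition patterns : seq bitseq :=
  flatten [seq [seq w <- bitseqs 6 | count id w == n] | n <- iota 0 7].

Definition particles (w : bitseq) : seq cell := mask w offsets.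
Definition occupied (s : seq cell) : config := fun c => c \in s.

(** The cells whose next state depends on the state of a cell of [s]. *)
Definition observers (s : seq cell) : seq cell :=
  undup [seq c - o | c <- s, o <- offsets].

Definition table (f : local_rule) : bitseq := [seq apply_rule f w | w <- patterns].

Lemma mem_patterns a b c d e g : [:: a; b; c; d; e; g] \in patterns.
Proof. by case: a; case: b; case: c; case: d; case: e; case: g; vm_compute. Qed.

Lemma size_table f : size (table f) = 64%N.
Proof. by rewrite size_map; vm_compute. Qed.

Lemma nth_table b f w :
  w \in patterns -> nth b (table f) (index w patterns) = apply_rule f w.
Proof.
move=> w_pat; rewrite (nth_map [::]) ?index_mem //.
by rewrite nth_index.
Qed.

Lemma table_inj : injective table.
Proof.
move=> f h eq_fh.
apply: funext => a; apply: funext => b; apply: funext => c.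
apply: funext => d; apply: funext => e; apply: funext => g.
have := mem_patterns a b c d e g => w_pat.
by have := nth_table false f w_pat; rewrite eq_fh (nth_table false h w_pat).
Qed.

(** If the rule sent the empty neighborhood to 1, then the image of the empty
configuration would be full, hence infinite. *)
Lemma quiescent f :
  number_conserving (global_rule f) -> apply_rule f (nseq 6 false) = false.
Proof.
move=> /(_ (fun=> false))[].
  by apply: (@sub_finite_set _ _ set0) => //.
move=> fin0 _; apply/negP => f0; apply: infinite_nat.
pose row (n : nat) : cell := (n%:Z, 0).
suff : finite_set (row @^-1` [set c | global_rule f (fun=> false) c]).
  by apply: sub_finite_set => n _; exact: f0.
by apply: finite_preimage fin0 => m n _ _ [].
Qed.

(** Outside of the observers of [s] the neighborhoods are empty, so that the
image of the configuration with particle set [s] lives on the observers; this is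
the conservation law for that configuration written as a finite sum. *)
Lemma observers_total f (s : seq cell) :
  number_conserving (global_rule f) -> uniq s ->
  sumn [seq nat_of_bool (apply_rule f (view (occupied s) c)) | c <- observers s]
  = size s.
Proof.
move=> ncf uniq_s; have f0 := quiescent ncf.
have fin_s : finite_config (occupied s).
  by rewrite /finite_config /occupied; exact: finite_seq.
have total_seq (r : seq cell) (h : cell -> bool) :
    uniq r -> (forall c, c \notin r -> h c = false) ->
    \sum_(c \in [set: cell]) (h c : nat)%:Z = (\sum_(c <- r) h c)%N%:Z.
  move=> uniq_r h0; rewrite (big_morph Posz PoszD (erefl (Posz 0))).
  rewrite (@fsbigE _ _ _ _ _ r) //; last by move=> c _ /h0 ->.
  by apply: eq_bigl => c; rewrite in_setT.
have [_] := ncf _ fin_s.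
rewrite (total_seq (observers s)) ?undup_uniq // => [|c].
  rewrite (total_seq s) // => [[]|c /negbTE//].
  rewrite [X in _ = X](eq_big_seq (fun=> 1%N)); last first.
    by move=> c; rewrite /occupied => ->.
  rewrite sum1_size sumnE big_map => <-.
  by apply: eq_bigr => c _; rewrite global_ruleE.
rewrite mem_undup global_ruleE => c_out.
rewrite (_ : view _ _ = nseq 6 false) ?f0 //.
rewrite /view (_ : nseq 6 false = [seq false | o <- offsets]) //.
apply/eq_in_map => o o_in; apply/negbTE; apply: contra c_out => c_in.
by apply/allpairsP; exists (c + o, o); rewrite /= addrK.
Qed.

End Balance.

(** * Exhaustive search for the solutions of the balance equations *)

Section Search.
Import GRing.Theory.
Local Open Scope ring_scope.

(** The set of particles of pattern [w] gives an equation: the values of the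
rule at the neighborhoods listed in the first component sum to the second. *)
Definition equation (w : bitseq) : seq nat * nat :=
  let s := particles w in
  ([seq index (view (occupied s) c) patterns | c <- observers s], size s).

(** The pattern without particles has no observers, and its equation is void;
the value of the rule there vanishes for the separate reason that the image of
the empty configuration must be finite. *)
Definition equations : seq (seq nat * nat) :=
  ([:: index (nseq 6 false) patterns], 0%N) :: [seq equation w | w <- patterns].

(** A partial table [t] holds the values on the first [size t] patterns.  Reading
the unknown values once as 0 and once as 1 gives the least and the greatest
left-hand side that a completion of [t] can reach. *)
Definition consistent (t : bitseq) (e : seq nat * nat) : bool :=
  (sumn [seq nat_of_bool (nth false t i) | i <- e.1] <= e.2
     <= sumn [seq nat_of_bool (nth true t i) | i <- e.1])%N.

(** Only the equations that involve the newly assigned pattern [k] are tested: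
the status of the others has not changed. *)
Definition extend_tables (ts : seq bitseq) (k : nat) : seq bitseq :=
  let es := [seq e <- equations | k \in e.1] in
  [seq t <- flatten [seq [:: rcons t false; rcons t true] | t <- ts]
   | all (consistent t) es].

Definition balanced_tables : seq bitseq :=
  foldl extend_tables [:: [::]] (iota 0%N 64%N).

(** Replacing the entries beyond position [k] by 0 (by 1) can only decrease
(increase) the sum, so the search never drops a prefix of a solution. *)
Lemma consistent_take (t : bitseq) (e : seq nat * nat) (k : nat) :
  all (fun i => (i < size t)%N) e.1 ->
  sumn [seq nat_of_bool (nth false t i) | i <- e.1] = e.2 ->
  consistent (take k t) e.
Proof.
case: e => /= s n lt_s <-; rewrite /consistent /=.
elim: s lt_s => //= i s IHs /andP[lt_i /IHs/andP[le1 le2]].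
have [lt_k|le_k] := ltnP i k.
  by rewrite !nth_take // (set_nth_default false true) // !leq_add2l le1 le2.
have sz_take : (size (take k t) <= i)%N by rewrite size_take_min geq_min le_k.
rewrite !(nth_default _ sz_take).
by apply/andP; split; apply: leq_add => //; exact: leq_b1.
Qed.

Lemma mem_balanced_tables (t : bitseq) :
  size t = 64%N ->
  (forall e, e \in equations -> all (fun i => (i < 64)%N) e.1) ->
  (forall e, e \in equations ->
     sumn [seq nat_of_bool (nth false t i) | i <- e.1] = e.2) ->
  t \in balanced_tables.
Proof.
move=> sz_t lt_eq sat_t.
suff prefix k : (k <= 64)%N ->
    take k t \in foldl extend_tables [:: [::]] (iota 0 k).
  by have := prefix 64%N isT; rewrite -sz_t take_size sz_t.
elim: k => [|k IHk] le_k; first by rewrite take0.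
rewrite -addn1 iotaD foldl_cat addn1 /= add0n /extend_tables mem_filter.
apply/andP; split.
  apply/allP => e; rewrite mem_filter => /andP[_ e_eq].
  by apply: consistent_take; rewrite ?sz_t; [exact: lt_eq | exact: sat_t].
apply/flatten_mapP; exists (take k t); first by apply: IHk; exact: ltnW.
rewrite (take_nth false) ?sz_t // !inE.
by case: (nth _ _ _); rewrite eqxx ?orbT.
Qed.

Lemma conserving_table f :
  number_conserving (global_rule f) -> table f \in balanced_tables.
Proof.
move=> ncf.
have view_pat x c : view x c \in patterns by exact: mem_patterns.
apply: mem_balanced_tables; first exact: size_table.
  move=> e; rewrite inE => /orP[/eqP-> //|/mapP[w _ ->]].
  apply/allP => _ /mapP[c _ ->].
  have <- : size patterns = 64%N by vm_compute.
  by rewrite index_mem.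
have tableE w : w \in patterns ->
    nat_of_bool (nth false (table f) (index w patterns)) = apply_rule f w.
  by move=> w_pat; rewrite nth_table.
move=> e; rewrite inE => /orP[/eqP->|/mapP[w _ ->]].
  have := tableE _ (mem_patterns false false false false false false).
  by rewrite [apply_rule _ _](quiescent ncf) => /(congr1 (addn^~ 0%N)).
rewrite -[RHS]/(size (particles w)) -(observers_total ncf) ?mask_uniq //.
rewrite -[X in sumn X]map_comp; congr sumn.
by apply: eq_map => c; apply: tableE; exact: view_pat.
Qed.

End Search.

(** * Conservation by flux cancellation *)

Section Flux.
Import GRing.Theory.
Local Open Scope ring_scope.

Definition finsupp (g : cell -> int) : Prop := finite_set [set c | g c != 0].

Definition total (g : cell -> int) : int := \sum_(c \in [set: cell]) g c.

Lemma totalD g h : finsupp g -> finsupp h ->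
  total (fun c => g c + h c) = total g + total h.
Proof.
move=> fin_g fin_h; pose D := [set c | g c != 0] `|` [set c | h c != 0].
have fin_D : finite_set D by rewrite finite_setU.
have totalE k : (forall c, k c != 0 -> D c) -> total k = \sum_(c \in D) k c.
  move=> kD; rewrite /total -(fsbig_widen D) // => c [_ /= nDc].
  by apply/eqP/negPn/negP => /kD.
rewrite !totalE ?fsbig_split //.
- by move=> c hc; right.
- by move=> c gc; left.
- move=> c; have [gc|gc] := eqVneq (g c) 0; last by left.
  by rewrite gc add0r; right.
Qed.

Lemma total_shift g v : total (fun c => g (c - v)) = total g.
Proof.
rewrite /total -(reindex_fsbigT (fun c => c - v)) //.
by exists (fun c => c + v) => c; rewrite ?subrK ?addrK.
Qed.

Lemma finsupp_shift g v : finsupp g -> finsupp (fun c => g (c - v)).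
Proof. by apply: finite_preimage => c d _ _ /subIr. Qed.

(** The equation between [F] and the flux [J] is written without subtraction, so
that summing it over the plane only uses additivity: both sides contain the
total flux, once shifted by [e]. *)
Lemma flux_conserving (F : config -> config) (v e : cell)
    (J : config -> cell -> int) :
  (forall x, finite_config x -> finsupp (J x)) ->
  (forall x c, (F x c : nat)%:Z + J x c = (x (c - v) : nat)%:Z + J x (c - e)) ->
  number_conserving F.
Proof.
move=> finJ FE x fin_x; have fin_Jx := finJ x fin_x.
have fin_x' : finsupp (fun c => (x c : nat)%:Z).
  by apply: sub_finite_set fin_x => c /=; case: (x c).
have fin_xv := finsupp_shift v fin_x'; have fin_Je := finsupp_shift e fin_Jx.
have fin_F : finite_config (F x).
  apply: (@sub_finite_set _ _ ([set c | (x (c - v) : nat)%:Z != 0]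
    `|` [set c | J x (c - e) != 0] `|` [set c | J x c != 0])); last first.
    by rewrite !finite_setU.
  move=> c /= Fc; have := FE x c; rewrite Fc.
  have [->|] := eqVneq (J x c) 0; last by right.
  have [->|] := eqVneq (J x (c - e)) 0; last by left; right.
  by rewrite !addr0 => <-; left; left.
split=> //; have fin_F' : finsupp (fun c => (F x c : nat)%:Z).
  by apply: sub_finite_set fin_F => c /=; case: (F x c).
apply: (addIr (total (J x))).
transitivity (total (fun c => (x (c - v) : nat)%:Z + J x (c - e))).
  rewrite -[LHS](totalD fin_F' fin_Jx).
  by apply: eq_fsbigr => c _; exact: FE.
by rewrite (totalD fin_xv fin_Je) (total_shift (fun c => (x c : nat)%:Z))
  (total_shift (J x)).
Qed.

Lemma shift_conserving v : number_conserving (shift v).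
Proof.
apply: (@flux_conserving _ v 0 (fun _ _ => 0)) => [x _|x [i j]].
  by apply: (@sub_finite_set _ _ set0) => // c /=; rewrite eqxx.
by [].
Qed.

(** The net flux to the right between (i, j) and (i + 1, j), when the particles
move in row [j + p] and the conditions are read in row [j + q]. *)
Definition row_flux (C : {set word} * {set word}) (p q : int) (x : config)
    (c : cell) : int :=
  let: (i, j) := c in
  let y := (x (i, j + q), x (i + 1, j + q)) in
  ([&& x (i, j + p), ~~ x (i + 1, j + p) & y \in C.2] : nat)%:Z
  - ([&& x (i + 1, j + p), ~~ x (i, j + p) & y \in C.1] : nat)%:Z.

Lemma finsupp_row_flux C p q x : finite_config x -> finsupp (row_flux C p q x).
Proof.
move=> fin_x.
have fin_t (t : cell) : finite_set [set c | x (c + t)].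
  by apply: finite_preimage fin_x => c d _ _ /addIr.
apply: (@sub_finite_set _ _ ([set c | x (c + (0, p))] `|` [set c | x (c + (1, p))])).
  move=> [i j]; rewrite /= /row_flux.
  have add2E (k l : int) : (i, j) + (k, l) = (i + k, j + l) by [].
  rewrite !add2E addr0; case: (x (i, _)); first by left.
  by case: (x (i + 1, _)) => //; right.
by rewrite finite_setU.
Qed.

Lemma traffic_conserving C : C \in conditions -> number_conserving (traffic C).
Proof.
move=> C_cond; apply: (@flux_conserving _ 0 (1, 0) (row_flux C 0 (- 1))).
  by move=> x; exact: finsupp_row_flux.
move=> x [i j]; rewrite trafficE // subr0.
have -> : (i, j) - (1, 0) = (i - 1, j) :> cell by congr pair; rewrite subr0.
by rewrite /T_value /row_flux !addr0 !subrK; ring.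
Qed.

Lemma shifted_traffic_conserving C :
  C \in conditions -> number_conserving (shifted_traffic C).
Proof.
move=> C_cond; apply: (@flux_conserving _ (0, 1) (1, 0) (row_flux C (- 1) 0)).
  by move=> x; exact: finsupp_row_flux.
move=> x [i j]; rewrite shifted_trafficE //.
have -> : (i, j) - (1, 0) = (i - 1, j) :> cell by congr pair; rewrite subr0.
have -> : (i, j) - (0, 1) = (i, j - 1) :> cell by congr pair; rewrite subr0.
by rewrite /ST_value /row_flux !addr0 !subrK; ring.
Qed.

End Flux.

(** * The listed maps as cellular automata *)

Section Listing.
Import GRing.Theory.
Local Open Scope ring_scope.

(** The defining expression of T at a cell, as a function of the neighborhood. *)
Definition conditional_traffic (l r : seq word) : local_rule :=
  fun a b c d e g =>
    (b : nat)%:Z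
    - ([&& b, ~~ c & (e, g) \in r] : nat)%:Z
    + ([&& a, ~~ b & (d, e) \in r] : nat)%:Z
    - ([&& b, ~~ a & (d, e) \in l] : nat)%:Z
    + ([&& c, ~~ b & (e, g) \in l] : nat)%:Z == 1.

(** ST is T with the roles of the two rows of the neighborhood exchanged: the
particles of the lower row move, under conditions read in the upper row, and the
result appears in the upper row. *)
Definition swap_rows (f : local_rule) : local_rule :=
  fun a b c d e g => f d e g a b c.

Fixpoint sublists (T : Type) (s : seq T) : seq (seq T) :=
  if s is x :: s' then
    [seq x :: t | t <- sublists s'] ++ sublists s' else [:: [::]].

Definition letters : seq word := [:: w00; w01; w10; w11].

(** The counterpart of [conditions] for subsets given as sublists of [letters],
which, unlike finite sets, can be enumerated by evaluation. *)
Definition condition_lists : seq (seq word * seq word) :=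
  [seq p <- [seq (l, r) | l <- sublists letters, r <- sublists letters]
   | nilp p.1 (+) nilp p.2
     || (p \in [:: ([:: w00], [:: w11]); ([:: w01], [:: w01]);
                   ([:: w10], [:: w10]); ([:: w11], [:: w00])])].

Definition projections : seq local_rule :=
  [:: fun a b c d e g => b; fun a b c d e g => c; fun a b c d e g => a;
      fun a b c d e g => e; fun a b c d e g => d; fun a b c d e g => g].

Definition listed_rules : seq local_rule :=
  let traffics := [seq conditional_traffic p.1 p.2 | p <- condition_lists] in
  projections ++ traffics ++ [seq swap_rows f | f <- traffics].

Definition condition_of (p : seq word * seq word) : {set word} * {set word} :=
  ([set w in p.1], [set w in p.2])%SET.

Lemma traffic_rule p :
  traffic (condition_of p) = global_rule (conditional_traffic p.1 p.2).
Proof.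
apply: funext => x; apply: funext => -[i j].
by rewrite /traffic /T_value !finset.inE.
Qed.

Lemma shifted_traffic_rule p :
  shifted_traffic (condition_of p) =
    global_rule (swap_rows (conditional_traffic p.1 p.2)).
Proof.
apply: funext => x; apply: funext => -[i j].
by rewrite /shifted_traffic /ST_value !finset.inE.
Qed.

Lemma projection_rules : class_shift = [seq global_rule f | f <- projections].
Proof.
rewrite /class_shift /=.
repeat (congr cons); apply: funext => x; apply: funext => -[i j] //=;
  by rewrite /shift /= ?subr0 ?opprK.
Qed.

Lemma filter_sublists (T : eqType) (a : pred T) (s : seq T) :
  [seq x <- s | a x] \in sublists s.
Proof.
elim: s => //= x s IHs; rewrite mem_cat; case: (a x); last by rewrite IHs orbT.
by rewrite (map_f (cons x)).
Qed.

Lemma sublist_of_set (l : seq word) :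
  l \in sublists letters -> [seq w <- letters | w \in [set w in l]%SET] = l.
Proof.
have /allP filterK :
    all (fun l => [seq w <- letters | w \in l] == l) (sublists letters).
  by vm_compute.
move=> /filterK/eqP {2}<-; apply: eq_filter => w; exact: finset.in_set.
Qed.

(** With [sublist_of_set], sublists of [letters] and sets of words correspond
one to one. *)
Lemma set_of_sublist (A : {set word}) :
  [set w in [seq w <- letters | w \in A]]%SET = A.
Proof.
apply/setP => w; rewrite finset.in_set mem_filter.
by case: w => -[] []; rewrite andbT.
Qed.

Lemma eq_set_of_sublist (l m : seq word) :
  l \in sublists letters -> m \in sublists letters ->
  ([set w in l]%SET == [set w in m]%SET) = (l == m).
Proof.
move=> /sublist_of_set {2}<- /sublist_of_set {2}<-.
by apply/eqP/eqP => [->|/(congr1 (fun s => [set w in s]%SET))];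
  rewrite ?set_of_sublist.
Qed.

Lemma mem_condition_of p :
  p.1 \in sublists letters -> p.2 \in sublists letters ->
  (condition_of p \in conditions) = (p \in condition_lists).
Proof.
case: p => l r; rewrite ![(l, r).1]/= ![(l, r).2]/= => l_sub r_sub.
have set0E : finset.set0 = [set w in [::]]%SET :> {set word}.
  by apply/setP => w; rewrite !finset.inE.
have set1E (u : word) : [set u]%SET = [set w in [:: u]]%SET.
  by apply/setP => w; rewrite !finset.inE.
have pairE (a b : word) :
    (condition_of (l, r) == ([set a], [set b])%SET) = ((l, r) == ([:: a], [:: b])).
  have sub1 u : [:: u] \in sublists letters by case: u => -[] []; vm_compute.
  by rewrite !xpair_eqE /= !set1E !eq_set_of_sublist.
have nil_sub : [::] \in sublists letters by vm_compute.
rewrite [RHS]mem_filter (allpairs_f pair l_sub r_sub) andbT.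
rewrite /conditions !finset.inE !pairE set0E !eq_set_of_sublist //.
by rewrite /nilp !size_eq0 !orbA.
Qed.

Lemma perm_enum_conditions :
  perm_eq (enum conditions) [seq condition_of p | p <- condition_lists].
Proof.
have sub p : p \in condition_lists ->
    p.1 \in sublists letters /\ p.2 \in sublists letters.
  by rewrite mem_filter => /andP[_ /allpairsP[[l r] [/= ? ? ->]]].
apply: uniq_perm; first exact: enum_uniq.
  rewrite map_inj_in_uniq; first by vm_compute.
  move=> [l r] [l' r'] /sub[/= l_sub r_sub] /sub[/= l'_sub r'_sub] [eq_l eq_r].
  by congr pair; apply/eqP; rewrite -eq_set_of_sublist // ?eq_l ?eq_r.
move=> C; rewrite mem_enum; apply/idP/mapP => [C_cond|[p p_in ->]]; last first.
  by have [? ?] := sub p p_in; rewrite mem_condition_of.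
pose p := ([seq w <- letters | w \in C.1], [seq w <- letters | w \in C.2]).
have pE : condition_of p = C.
  by rewrite /condition_of !set_of_sublist; case: (C).
exists p => //; rewrite -mem_condition_of ?pE //; exact: filter_sublists.
Qed.

Lemma card_conditions (P : pred ({set word} * {set word})) :
  #|[set C in conditions | P C]%SET| =
    count (fun p => P (condition_of p)) condition_lists.
Proof.
rewrite -[RHS]count_map.
rewrite -(permP perm_enum_conditions) -size_filter cardE; apply: perm_size.
apply: uniq_perm => [||C]; first exact: enum_uniq.
  by apply: filter_uniq; exact: enum_uniq.
by rewrite mem_filter !mem_enum finset.in_set andbC.
Qed.

Lemma perm_listed_maps :
  perm_eq listed_maps [seq global_rule f | f <- listed_rules].
Proof.
rewrite /listed_maps projection_rules /listed_rules !map_cat perm_cat2l.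
apply: perm_cat.
  have -> : [seq global_rule f | f <- [seq conditional_traffic p.1 p.2
                                         | p <- condition_lists]] =
            [seq traffic C | C <- [seq condition_of p | p <- condition_lists]].
    by rewrite -!map_comp; apply: eq_map => p; rewrite /= traffic_rule.
  exact/perm_map/perm_enum_conditions.
rewrite -2!map_comp.
rewrite (eq_map (g := shifted_traffic \o condition_of)); last first.
  by move=> p; rewrite /= shifted_traffic_rule.
by rewrite map_comp; exact/perm_map/perm_enum_conditions.
Qed.

(** The computation that settles necessity: the balance equations have no
solution beyond the listed rules. *)
Lemma exhaustive_search :
  all (fun t => t \in [seq table f | f <- listed_rules]) balanced_tables.
Proof. by vm_compute. Qed.

(** Every neighborhood pattern occurs around the origin in some configuration. *)
Lemma global_rule_inj : injective global_rule.
Proof.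
move=> f h eq_fh; apply: funext => a; apply: funext => b; apply: funext => c.
apply: funext => d; apply: funext => e; apply: funext => g.
pose x (p : cell) :=
  nth false [:: a; b; c; d; e; g] (index p offsets).
by have := congr1 (fun F => F x (0, 0)) eq_fh; vm_compute.
Qed.

Lemma uniq_listed_maps : uniq listed_maps.
Proof.
rewrite (perm_uniq perm_listed_maps) map_inj_uniq; last exact: global_rule_inj.
by apply: (map_uniq (f := table)); vm_compute.
Qed.

Lemma conserving_listed f :
  number_conserving (global_rule f) -> global_rule f \in listed_maps.
Proof.
move=> /conserving_table/(allP exhaustive_search)/mapP[h h_in /table_inj ->].
by rewrite (perm_mem perm_listed_maps) map_f.
Qed.

Lemma listed_conserving F : F \in listed_maps -> number_conserving F.
Proof.
rewrite !mem_cat => /or3P[|/mapP[C]|/mapP[C]].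
- rewrite inE => /orP[/eqP->|/mapP[v _ ->]]; last exact: shift_conserving.
  by [].
- by rewrite mem_enum => /traffic_conserving ? ->.
- by rewrite mem_enum => /shifted_traffic_conserving ? ->.
Qed.

Lemma listed_global_rule F : F \in listed_maps -> exists f, F = global_rule f.
Proof. by rewrite (perm_mem perm_listed_maps) => /mapP[f _ ->]; exists f. Qed.

Lemma card_eq_seq (T : eqType) (x0 : T) (s : seq T) :
  uniq s -> [set x | x \in s] #= `I_(size s).
Proof.
move=> uniq_s.
have -> : [set x | x \in s] = [set nth x0 s i | i in `I_(size s)].
  apply/seteqP; split=> [x /= /(nthP x0)[i lt_i <-]|_ [i lt_i <-]]; first by exists i.
  exact: mem_nth.
apply: inj_card_eq => i j; rewrite !inE /= => lt_i lt_j eq_ij.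
by apply/eqP; rewrite -(nth_uniq x0 lt_i lt_j uniq_s) eq_ij.
Qed.

End Listing.

Theorem mainTheorem1 :
  [/\ number_conserving_CA #= `I_74,
      number_conserving_CA = [set F | F \in listed_maps],
      forall f : local_rule,
        number_conserving (global_rule f) <->
        [\/ global_rule f \in class_shift,
            global_rule f \in class_traffic
          | global_rule f \in class_shifted_traffic],
      size listed_maps = 74 /\ uniq listed_maps
    & [/\ size class_shift = 6,
          size class_traffic = 34,
          size class_shifted_traffic = 34,
          #|[set C in conditions | C.2 == finset.set0]%SET| = 15
        & #|[set C in conditions | C.1 == finset.set0]%SET| = 15]].
Proof.
have CAE : number_conserving_CA = [set F | F \in listed_maps].
  apply/seteqP; split=> F /=; first by move=> [[f ->]]; exact: conserving_listed.
  by move=> F_in; split; [exact: listed_global_rule|exact: listed_conserving].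
have size_conditions : size (enum conditions) = 34.
  by rewrite (perm_size perm_enum_conditions) size_map; vm_compute.
have size_listed : size listed_maps = 74.
  by rewrite !size_cat !size_map size_conditions.
have set0E (l : seq word) : ([set w in l]%SET == finset.set0) = nilp l.
  apply/eqP/nilP => [/setP l0|->]; last by apply/setP => w; rewrite !finset.inE.
  by case: l l0 => // u l /(_ u); rewrite !finset.inE eqxx.
split=> //.
- rewrite CAE -size_listed.
  exact: (@card_eq_seq _ (idfun : config -> config)
    listed_maps uniq_listed_maps).
- move=> f; split => [/conserving_listed|f_in].
    by rewrite !mem_cat => /or3P.
  by apply: listed_conserving; rewrite !mem_cat; apply/or3P.
- by split=> //; exact: uniq_listed_maps.
split; rewrite ?size_map //.
- by rewrite card_conditions; under eq_count do rewrite set0E; vm_compute.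
- by rewrite card_conditions; under eq_count do rewrite set0E; vm_compute.
Qed.
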